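(* For any pseudo-valuation $\mu$ on $K[x]$, the interval $[\mu_0,\mu)=\{\nu\in\mathbb{V}\mid\mu_0\le\nu<\mu\}$ is contained in $\mathbb{V}^{\mathrm{ind}}$ and is totally ordered.
   Context: $K$ is a field with a discrete valuation $v\colon K^*\to\mathbb{Z}$, $v(K^* )=\mathbb{Z}$. $\mathbb{V}$ is the set of discrete valuations $\mu\colon K(x)^*\to\mathbb{Q}$ (so $\Gamma(\mu)=\mu(K(x)^* )$ is cyclic) with $\mu|_K=v$ and $\mu(x)\ge0$; put $\mu(0)=\infty$. A pseudo-valuation on $K[x]$ is a map $\mu\colon K[x]\to\mathbb{Q}\cup\{\infty\}$ extending $v$, with the same properties as a valuation ($\mu(gh)=\mu(g)+\mu(h)$, $\mu(g+h)\ge\min\{\mu(g),\mu(h)\}$, $\mu(1)=0$, $\mu(0)=\infty$), except that the prime ideal $\mu^{-1}(\infty)$ is not necessarily zero. For valuations or pseudo-valuations, $\mu\le\mu'$ means $\mu(g)\le\mu'(g)$ for all $g\in K[x]$, and $\mu<\mu'$ means $\mu\le\mu'$ and $\mu\ne\mu'$ on $K[x]$. $\mu_0\in\mathbb{V}$ is given by $\mu_0(\sum_sa_sx^s)=\min_sv(a_s)$; it is the minimum of $\mathbb{V}$. For $\mu\in\mathbb V$ and $\alpha\in\Gamma(\mu)$, $\mathcal P_\alpha=\{g\in K[x]:\mu(g)\ge\alpha\}$, $\mathcal P_\alpha^+=\{g\in K[x]:\mu(g)>\alpha\}$, $\mathcal{G}r(\mu)=\bigoplus_{\alpha\in\Gamma(\mu)}\mathcal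 P_\alpha/\mathcal P_\alpha^+$, $H_\mu(0)=0$ and $H_\mu(g)=g+\mathcal P^+_{\mu(g)}$ for $g\neq0$; $h\mid_\mu g$ means that $H_\mu(h)$ divides $H_\mu(g)$ in $\mathcal{G}r(\mu)$. A key polynomial for $\mu$ is a monic $\phi\in K[x]$ of positive degree such that $H_\mu(\phi)\mathcal{G}r(\mu)$ is a non-zero prime ideal and $\phi\nmid_\mu g$ for all non-zero $g$ with $\deg g<\deg\phi$. For such $\phi$ and $\lambda\in\mathbb{Q}_{>0}$, the augmented valuation $[\mu;(\phi,\lambda)]\in\mathbb V$ is $\sum_s g_s\phi^s\mapsto\min_s\{\mu(g_s\phi^s)+s\lambda\}$ on $\phi$-expansions ($\deg g_s<\deg\phi$). $\mathbb{V}^{\mathrm{ind}}\subset\mathbb{V}$ is the set of inductive valuations: those obtained from $\mu_0$ by a finite number of augmentation steps. *)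

(* Defs.v *)
From HB Require Import structures.
From mathcomp Require Import all_boot all_order all_algebra.
From mathcomp Require Import ring_quotient.
From mathcomp Require Import boolp constructive_ereal.

Set Implicit Arguments.
Unset Strict Implicit.
Unset Printing Implicit Defensive.

Import Order.TTheory GRing.Theory Num.Theory.
Local Open Scope ring_scope.
Local Open Scope quotient_scope.

(* Values lie in Q u {oo}, rendered as the elements of \bar rat other than
   -oo. *)
Definition pseudo_valuation_axioms (R : comNzRingType) (w : R -> \bar rat)
    : Prop :=
  [/\ forall a, w a != -oo%E,
      w 0 = +oo%E,
      w 1 = 0%E,
      forall a b, w (a * b)%R = (w a + w b)%E
    & forall a b, (mine (w a) (w b) <= w (a + b)%R)%E].

Definition valuation (F : fieldType) (w : F -> \bar rat) : Prop :=
  pseudo_valuation_axioms w /\ forall a, a != 0 -> w a \is a fin_num.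

Definition value_group (F : fieldType) (w : F -> \bar rat) (alpha : rat)
    : Prop :=
  exists2 a, a != 0 & w a = alpha%:E.

Definition normalized_discrete_valuation (K : fieldType) (v : K -> \bar rat)
    : Prop :=
  valuation v /\
  forall alpha, value_group v alpha <-> exists n : int, alpha = n%:~R.

Definition pseudo_valuation (K : fieldType) (v : K -> \bar rat)
    (mu : {poly K} -> \bar rat) : Prop :=
  pseudo_valuation_axioms mu /\ forall a : K, mu a%:P = v a.

Definition cyclic_group (G : rat -> Prop) : Prop :=
  exists d : rat, forall alpha, G alpha <-> exists n : int, alpha = d *~ n.

Record discval (K : fieldType) (v : K -> \bar rat) := Discval {
  discval_fun :> {fraction {poly K}} -> \bar rat;
  discvalP : valuation discval_fun;
  discval_cyclic : cyclic_group (value_group discval_fun);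
  discval_ext : forall a : K, discval_fun (tofrac a%:P) = v a;
  discval_x : (0 <= discval_fun (tofrac 'X))%E
}.

Definition pval (K : fieldType) (v : K -> \bar rat) (mu : discval v)
    (g : {poly K}) : \bar rat := mu (tofrac g).

Definition le_pv (K : fieldType) (mu mu' : {poly K} -> \bar rat) : Prop :=
  forall g, (mu g <= mu' g)%E.

Definition lt_pv (K : fieldType) (mu mu' : {poly K} -> \bar rat) : Prop :=
  le_pv mu mu' /\ ~ (mu =1 mu').

Definition gauss (K : fieldType) (v : K -> \bar rat) (g : {poly K})
    : \bar rat :=
  \big[mine/+oo%E]_(s < size g) v g`_s.

Section GradedAlgebra.
Context (K : fieldType) (v : K -> \bar rat) (mu : discval v).

Lemma pvalN1 g : pval mu g != -oo%E.
Proof. by rewrite /pval; case: (discvalP mu) => -[H _ _ _ _] _; apply: H. Qed.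

Lemma pval0 : pval mu 0 = +oo%E.
Proof. by rewrite /pval rmorph0; case: (discvalP mu) => -[_ H _ _ _] _. Qed.

Lemma pval1 : pval mu 1 = 0%E.
Proof. by rewrite /pval rmorph1; case: (discvalP mu) => -[_ _ H _ _] _. Qed.

Lemma pvalM g h : pval mu (g * h) = (pval mu g + pval mu h)%E.
Proof.
by rewrite /pval rmorphM; case: (discvalP mu) => -[_ _ _ H _] _; apply: H.
Qed.

Lemma pvalD g h : (mine (pval mu g) (pval mu h) <= pval mu (g + h)%R)%E.
Proof.
by rewrite /pval rmorphD; case: (discvalP mu) => -[_ _ _ _ H] _; apply: H.
Qed.

Lemma pval_fin g : g != 0 -> pval mu g \is a fin_num.
Proof. by move=> g0; case: (discvalP mu) => _; apply; rewrite tofrac_eq0. Qed.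

Lemma pvalN g : pval mu (- g) = pval mu g.
Proof.
have f1 : pval mu (-1) \is a fin_num by rewrite pval_fin // oppr_eq0 oner_neq0.
have : (pval mu (-1)%R + pval mu (-1)%R = 0)%E by rewrite -pvalM mulrNN mulr1 pval1.
rewrite -(mulN1r g) pvalM; case: (pval mu (-1)) f1 => // r _ [] r0.
suff -> : r = 0 by rewrite add0e.
have /eqP : r + r = 0 by exact: r0.
by rewrite -mulr2n mulrn_eq0 => /eqP.
Qed.

Lemma pval_gtD a g h : (a < pval mu g)%E -> (a < pval mu h)%E ->
  (a < pval mu (g + h)%R)%E.
Proof. by move=> ag ah; apply: lt_le_trans (pvalD g h); rewrite lt_min ag. Qed.

Lemma pval_gt_sum (I : Type) (a : \bar rat) (r : seq I) (P : pred I) F :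
  (a < +oo)%E ->
  (forall i, P i -> (a < pval mu (F i))%E) ->
  (a < pval mu (\sum_(i <- r | P i) F i)%R)%E.
Proof.
move=> a0 H; elim/big_ind: _ => //; first by rewrite pval0.
exact: pval_gtD.
Qed.

Lemma value_group0 : value_group mu 0.
Proof. by exists 1; [exact: oner_neq0 | case: (discvalP mu) => -[]]. Qed.

Lemma value_groupD a b :
  value_group mu a -> value_group mu b -> value_group mu (a + b).
Proof.
move=> [f f0 fa] [g g0 gb]; exists (f * g); first by rewrite mulf_neq0.
by case: (discvalP mu) => -[_ _ _ H _] _; rewrite H fa gb.
Qed.

(* A pair (alpha, g) with g in P_alpha stands for the class of g in
   P_alpha / P_alpha^+, and a list of such pairs for the sum of these
   classes. *)
Definition homogeneous (p : rat * {poly K}) : bool :=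
  `[< value_group mu p.1 >] && (p.1%:E <= pval mu p.2)%E.

Record hsum := HSum {
  terms :> seq (rat * {poly K});
  _ : all homogeneous terms
}.

HB.instance Definition _ := [isSub for terms].
HB.instance Definition _ := [Choice of hsum by <:].

Definition component (alpha : rat) (s : seq (rat * {poly K})) : {poly K} :=
  \sum_(p <- s | p.1 == alpha) p.2.

(* Equality in the direct sum: for every alpha the components of degree alpha
   are congruent modulo P_alpha^+ (outside the value group both are 0). *)
Definition hsum_eq (s t : hsum) : bool :=
  `[< forall alpha : rat,
        (alpha%:E < pval mu (component alpha s - component alpha t)%R)%E >].

Lemma hsum_eq_refl : reflexive hsum_eq.
Proof. by move=> s; apply/asboolP => a; rewrite subrr pval0 ltry. Qed.

Lemma hsum_eq_sym : symmetric hsum_eq.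
Proof.
move=> s t; apply/asboolP/asboolP => H a;
by rewrite -pvalN opprB.
Qed.

Lemma hsum_eq_trans : transitive hsum_eq.
Proof.
move=> t s u /asboolP st /asboolP tu; apply/asboolP => a.
by rewrite -(subrKA (component a t)) pval_gtD.
Qed.

Canonical hsum_eq_equiv :=
  EquivRel hsum_eq hsum_eq_refl hsum_eq_sym hsum_eq_trans.

Definition gr := {eq_quot hsum_eq}.

HB.instance Definition _ : EqQuotient _ hsum_eq gr := EqQuotient.on gr.
HB.instance Definition _ := Choice.on gr.

Definition mul_term (p q : rat * {poly K}) := (p.1 + q.1, p.2 * q.2).

Lemma hsum_zero_subproof : all homogeneous [::]. Proof. by []. Qed.

Lemma hsum_one_subproof : all homogeneous [:: (0, 1)].
Proof.
by rewrite /= andbT /homogeneous pval1 /= lexx andbT; apply/asboolP/value_group0.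
Qed.

Lemma hsum_opp_subproof (s : hsum) :
  all homogeneous [seq (p.1, - p.2) | p <- s].
Proof.
case: s => s /= /allP H; apply/allP => _ /mapP[p ps ->].
by rewrite /homogeneous pvalN; exact: (H p ps).
Qed.

Lemma hsum_add_subproof (s t : hsum) : all homogeneous (s ++ t).
Proof. by case: s t => s Hs [t Ht]; rewrite all_cat Hs. Qed.

Lemma hsum_mul_subproof (s t : hsum) :
  all homogeneous [seq mul_term p q | p <- s, q <- t].
Proof.
case: s t => s /= /allP Hs [t /= /allP Ht]; apply/allP => _ /allpairsP[[p q] /= [ps qt ->]].
have /andP[/asboolP p1 p2] := Hs _ ps.
have /andP[/asboolP q1 q2] := Ht _ qt.
apply/andP; split => /=; first exact/asboolP/value_groupD.
by rewrite pvalM EFinD leeD.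
Qed.

Definition hsum_zero := HSum hsum_zero_subproof.
Definition hsum_one := HSum hsum_one_subproof.
Definition hsum_opp s := HSum (hsum_opp_subproof s).
Definition hsum_add s t := HSum (hsum_add_subproof s t).
Definition hsum_mul s t := HSum (hsum_mul_subproof s t).

Lemma component_zero a : component a hsum_zero = 0.
Proof. by rewrite /component big_nil. Qed.

Lemma component_opp a s : component a (hsum_opp s) = - component a s.
Proof. by rewrite /component big_map sumrN. Qed.

Lemma component_add a s t :
  component a (hsum_add s t) = component a s + component a t.
Proof. by rewrite /component big_cat. Qed.


Lemma component_mul a s t : component a (hsum_mul s t) =
  \sum_(p <- s) \sum_(q <- t) (if p.1 + q.1 == a then p.2 * q.2 else 0).
Proof. by rewrite /component big_mkcond big_allpairs_dep. Qed.

Lemma component_mulC a s t :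
  component a (hsum_mul s t) = component a (hsum_mul t s).
Proof.
rewrite !component_mul exchange_big; apply: eq_bigr => q _.
by apply: eq_bigr => p _; rewrite addrC mulrC.
Qed.

Lemma component_mulr a s t :
  component a (hsum_mul s t) = \sum_(p <- s) p.2 * component (a - p.1) t.
Proof.
rewrite component_mul; apply: eq_bigr => p _.
rewrite /component mulr_sumr [RHS]big_mkcond; apply: eq_bigr => q _.
by rewrite [q.1 == _]eq_sym subr_eq [a == _]eq_sym [q.1 + _]addrC.
Qed.

Definition gr_zero : gr := \pi_gr hsum_zero.
Definition gr_one : gr := \pi_gr hsum_one.
Definition gr_opp (x : gr) : gr := \pi_gr (hsum_opp (repr x)).
Definition gr_add (x y : gr) : gr := \pi_gr (hsum_add (repr x) (repr y)).
Definition gr_mul (x y : gr) : gr := \pi_gr (hsum_mul (repr x) (repr y)).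

Lemma grW (P : gr -> Prop) : (forall s, P (\pi_gr s)) -> forall x, P x.
Proof. by move=> H x; rewrite -[x]reprK. Qed.

Lemma pi_grP (s t : hsum) :
  (forall a, (a%:E < pval mu (component a s - component a t)%R)%E) <->
  \pi_gr s = \pi_gr t.
Proof.
split=> [H|/eqmodP/asboolP //].
by apply/eqmodP/asboolP.
Qed.

Lemma pi_gr_eq (s t : hsum) :
  (forall a, component a s = component a t) -> \pi_gr s = \pi_gr t.
Proof. by move=> H; apply/pi_grP => a; rewrite H subrr pval0 ltry. Qed.

Lemma repr_grP (s : hsum) a :
  (a%:E < pval mu (component a (repr (\pi_gr s)) - component a s)%R)%E.
Proof. by move: a; apply/pi_grP; rewrite reprK. Qed.

Lemma pi_gr_opp s : gr_opp (\pi_gr s) = \pi_gr (hsum_opp s).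
Proof.
apply/pi_grP => a; rewrite !component_opp -opprD pvalN; exact: repr_grP.
Qed.

Lemma pi_gr_add s t : gr_add (\pi_gr s) (\pi_gr t) = \pi_gr (hsum_add s t).
Proof.
apply/pi_grP => a; rewrite !component_add opprD addrACA.
by apply: pval_gtD; exact: repr_grP.
Qed.

Lemma pi_gr_mulr s t t' : \pi_gr t = \pi_gr t' ->
  \pi_gr (hsum_mul s t) = \pi_gr (hsum_mul s t').
Proof.
move=> /pi_grP H; apply/pi_grP => a.
rewrite !component_mulr -sumrB big_seq_cond.
apply: pval_gt_sum; first exact: ltry.
move=> p /andP[ps _]; rewrite -mulrBr pvalM.
have [_ p2] : value_group mu p.1 /\ (p.1%:E <= pval mu p.2)%E.
  by case: s ps => s /= /allP Hs /Hs /andP[/asboolP].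
have -> : a%:E = (p.1%:E + (a - p.1)%:E)%E by rewrite -EFinD addrC subrK.
exact: lee_ltD.
Qed.

Lemma hsum_mulC s t : \pi_gr (hsum_mul s t) = \pi_gr (hsum_mul t s).
Proof. by apply: pi_gr_eq => a; exact: component_mulC. Qed.

Lemma pi_gr_mul s t : gr_mul (\pi_gr s) (\pi_gr t) = \pi_gr (hsum_mul s t).
Proof.
rewrite /gr_mul (@pi_gr_mulr _ _ t) ?reprK // hsum_mulC.
by rewrite (@pi_gr_mulr _ _ s) ?reprK // hsum_mulC.
Qed.

Lemma gr_addA : associative gr_add.
Proof.
elim/grW=> s; elim/grW=> t; elim/grW=> u; rewrite !pi_gr_add.
by apply: pi_gr_eq => a; rewrite !component_add addrA.
Qed.

Lemma gr_addC : commutative gr_add.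
Proof.
elim/grW=> s; elim/grW=> t; rewrite !pi_gr_add.
by apply: pi_gr_eq => a; rewrite !component_add addrC.
Qed.

Lemma gr_add0 : left_id gr_zero gr_add.
Proof.
elim/grW=> s; rewrite !pi_gr_add.
by apply: pi_gr_eq => a; rewrite !component_add component_zero add0r.
Qed.

Lemma gr_addN : left_inverse gr_zero gr_opp gr_add.
Proof.
elim/grW=> s; rewrite pi_gr_opp !pi_gr_add.
apply: pi_gr_eq => a.
by rewrite !component_add component_opp component_zero addNr.
Qed.

HB.instance Definition _ :=
  GRing.isZmodule.Build gr gr_addA gr_addC gr_add0 gr_addN.

Lemma gr_mulA : associative gr_mul.
Proof.
elim/grW=> s; elim/grW=> t; elim/grW=> u; rewrite !pi_gr_mul.
apply: pi_gr_eq => a; rewrite component_mulr component_mulC component_mulr.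
under eq_bigr do rewrite component_mulC component_mulr mulr_sumr.
under [RHS]eq_bigr do rewrite component_mulr mulr_sumr.
rewrite exchange_big /=; apply: eq_bigr => q _; apply: eq_bigr => p _.
by rewrite mulrCA addrAC.
Qed.

Lemma gr_mulC : commutative gr_mul.
Proof. by elim/grW=> s; elim/grW=> t; rewrite !pi_gr_mul hsum_mulC. Qed.

Lemma gr_mul1 : left_id gr_one gr_mul.
Proof.
elim/grW=> s; rewrite pi_gr_mul; apply: pi_gr_eq => a.
by rewrite component_mulr /= big_seq1 /= mul1r subr0.
Qed.

Lemma gr_mulDl : left_distributive gr_mul gr_add.
Proof.
elim/grW=> s; elim/grW=> t; elim/grW=> u.
rewrite !(pi_gr_mul, pi_gr_add); apply: pi_gr_eq => a.
by rewrite component_add !component_mulr /= big_cat.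
Qed.

Lemma gr_one_neq0 : gr_one != 0.
Proof.
apply/eqP => /pi_grP /(_ 0).
by rewrite component_zero subr0 /component big_mkcond big_seq1 eqxx pval1 ltxx.
Qed.

HB.instance Definition _ := GRing.Zmodule_isComNzRing.Build gr
  gr_mulA gr_mulC gr_mul1 gr_mulDl gr_one_neq0.

End GradedAlgebra.

Section InitialForm.
Context (K : fieldType) (v : K -> \bar rat) (mu : discval v).

Lemma initial_form_subproof (g : {poly K}) :
  all (homogeneous mu) (if g == 0 then [::] else [:: (fine (pval mu g), g)]).
Proof.
case: eqP => //= /eqP g0; rewrite andbT /homogeneous /= fineK ?pval_fin //.
rewrite lexx andbT; apply/asboolP; exists (tofrac g); first by rewrite tofrac_eq0.
by rewrite fineK ?pval_fin.
Qed.

Definition initial_form (g : {poly K}) : gr mu :=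
  \pi_(gr mu) (HSum (initial_form_subproof g)).

End InitialForm.

Definition divides (R : comNzRingType) (a b : R) : Prop := exists c, b = c * a.

Definition principal_ideal (R : comNzRingType) (a : R) : {pred R} :=
  fun b => `[< divides a b >].

Definition prime_ideal (R : comNzRingType) (S : {pred R}) : Prop :=
  idealr_closed S /\ prime_idealr_closed S.

Section Inductive.
Context (K : fieldType) (v : K -> \bar rat).

Definition key_polynomial (mu : discval v) (phi : {poly K}) : Prop :=
  [/\ phi \is monic,
      (1 < size phi)%N,
      initial_form mu phi != 0,
      prime_ideal (principal_ideal (initial_form mu phi))
    & forall g : {poly K}, g != 0 -> (size g < size phi)%N ->
        ~ divides (initial_form mu phi) (initial_form mu g)].

(* mu' = [mu; (phi, lambda)]; a rational function is a quotient of
   polynomials, so mu' is determined by its values on phi-expansions. *)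
Definition augmentation (mu : discval v) (phi : {poly K}) (lambda : rat)
    (mu' : discval v) : Prop :=
  forall (n : nat) (g : 'I_n -> {poly K}),
    (forall s, size (g s) < size phi)%N ->
    pval mu' (\sum_(s < n) g s * phi ^+ s) =
    \big[mine/+oo%E]_(s < n) (pval mu (g s * phi ^+ s)%R + (lambda *+ s)%:E)%E.

Inductive inductive_valuation : discval v -> Prop :=
| Inductive_gauss (mu : discval v) :
    pval mu =1 gauss v -> inductive_valuation mu
| Inductive_augment (mu mu' : discval v) (phi : {poly K}) (lambda : rat) :
    inductive_valuation mu -> key_polynomial mu phi -> 0 < lambda ->
    augmentation mu phi lambda mu' -> inductive_valuation mu'.

Definition mu0_interval (mu : {poly K} -> \bar rat) (nu : discval v) : Prop :=
  le_pv (gauss v) (pval nu) /\ lt_pv (pval nu) mu.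

End Inductive.

(* Main.v *)
Require Import Defs.
From mathcomp Require Import all_boot all_order all_algebra.
From mathcomp Require Import ring_quotient zify lra.
From mathcomp Require Import boolp constructive_ereal.

(* If rho < tau are (pseudo-)valuations, let psi be monic of least degree with
   rho psi < tau psi.  Then rho is the minimum of the values of the terms of a
   psi-expansion, and rho g < tau g holds exactly when the constant term of the
   psi-expansion of g does not attain this minimum.  So psi is a key polynomial
   for rho, and the augmentation of rho that gives psi the value tau psi lies
   between rho and tau.

   Moreover rho < nu <= tau and nu f < tau f imply rho f < nu f, because psi
   serves both pairs.  Starting from the Gauss valuation and augmenting towards
   nu, the value of f thus increases strictly in the discrete group of nu while
   staying below nu f, so that nu is reached after finitely many steps.  Two
   valuations below mu are compared on the psi-expansions of the one whose psi
   has the smaller degree. *)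

Set Implicit Arguments.
Unset Strict Implicit.
Unset Printing Implicit Defensive.

Import Order.TTheory GRing.Theory Num.Theory.
Local Open Scope ring_scope.
Local Open Scope quotient_scope.

(** * Elementary properties of pseudo-valuations *)

(** Only the additive properties are assumed, so that this also serves for [expansion_val] before it
    is known to be multiplicative. *)
Lemma nonarchimedean_ltl (V : zmodType) (w : V -> \bar rat)
    (wD : forall a b, (mine (w a) (w b) <= w (a + b)%R)%E)
    (wN : forall a, w (- a) = w a) a b :
  (w a < w b)%E -> w (a + b) = w a.
Proof.
move=> ab; apply/le_anti/andP; split; last first.
  by apply: le_trans (wD a b); rewrite le_min lexx ltW.
have := wD (a + b) (- b); rewrite addrK wN ge_min.
by case/orP => // /(lt_le_trans ab); rewrite ltxx.
Qed.

Lemma ltn_divpl_size (K : fieldType) (psi g : {poly K}) : psi \is monic ->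
  g != 0 -> (1 < size psi)%N -> (size (g %/ psi)%R < size g)%N.
Proof.
move=> mpsi g0 spsi; rewrite size_divp ?monic_neq0 //.
by rewrite ltn_subrL size_poly_gt0 g0 andbT -subn1 subn_gt0.
Qed.

Section PseudoValuation.
Context (R : comNzRingType) (w : R -> \bar rat).
Context (pw : pseudo_valuation_axioms w).

Lemma pvNy a : w a != -oo%E. Proof. by case: pw. Qed.
Lemma pv0 : w 0 = +oo%E. Proof. by case: pw. Qed.
Lemma pv1 : w 1 = 0%E. Proof. by case: pw. Qed.
Lemma pvM a b : w (a * b) = (w a + w b)%E. Proof. by case: pw. Qed.
Lemma pvD a b : (mine (w a) (w b) <= w (a + b)%R)%E. Proof. by case: pw. Qed.

Lemma pv_fin a : (w a < +oo)%E -> w a \is a fin_num.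
Proof. by move=> wa; rewrite fin_numE pvNy lt_eqF. Qed.

Lemma pvN a : w (- a) = w a.
Proof.
have : (w (-1)%R + w (-1)%R = 0)%E by rewrite -pvM mulrNN mulr1 pv1.
rewrite -(mulN1r a) pvM; case: (w (-1)) (pvNy (-1)) => // r _ [] r0.
suff -> : r = 0 by rewrite add0e.
have /eqP : r + r = 0 by exact: r0.
by rewrite -mulr2n mulrn_eq0 => /eqP.
Qed.

Lemma pvD_ltl a b : (w a < w b)%E -> w (a + b) = w a.
Proof. exact: nonarchimedean_ltl pvD pvN a b. Qed.

Lemma pvD_ltr a b : (w b < w a)%E -> w (a + b) = w b.
Proof. by move=> ba; rewrite addrC pvD_ltl. Qed.

Lemma pv_gtD x a b : (x < w a)%E -> (x < w b)%E -> (x < w (a + b)%R)%E.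
Proof. by move=> xa xb; apply: lt_le_trans (pvD a b); rewrite lt_min xa. Qed.

Lemma pv_gt_sum (I : Type) (x : \bar rat) (r : seq I) (P : pred I) F :
  (x < +oo)%E -> (forall i, P i -> (x < w (F i))%E) ->
  (x < w (\sum_(i <- r | P i) F i)%R)%E.
Proof.
by move=> xy H; elim/big_ind: _ => // [|a b]; [rewrite pv0 | exact: pv_gtD].
Qed.

End PseudoValuation.

Lemma eq_or_lt_pv (K : fieldType) (rho tau : {poly K} -> \bar rat) :
  le_pv rho tau -> rho =1 tau \/ lt_pv rho tau.
Proof. by move=> le; have [e|ne] := pselect (rho =1 tau); [left | right]. Qed.

Lemma lt_pv_witness (K : fieldType) (rho tau : {poly K} -> \bar rat) :
  lt_pv rho tau -> exists g, (rho g < tau g)%E.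
Proof.
move=> [le ne]; apply: contrapT => /forallNP H; apply: ne => g.
by apply/le_anti; rewrite le leNgt; apply/negP/H.
Qed.

(** * The polynomial of least degree at which a valuation increases *)

Section MinimalPolynomial.
Context (K : fieldType) (rho : {poly K} -> \bar rat).
Context (prho : pseudo_valuation_axioms rho).

(** Minimality of the degree is recorded as equality of [rho] and [tau] in smaller degrees, the form
    in which it is applied. *)
Definition first_increase (tau : {poly K} -> \bar rat) (psi : {poly K}) :=
  [/\ psi \is monic, (1 < size psi)%N, (rho psi < tau psi)%E
    & forall g : {poly K}, (size g < size psi)%N -> rho g = tau g].

Section Increase.
Context (tau : {poly K} -> \bar rat) (psi : {poly K}).
Context (ptau : pseudo_valuation_axioms tau) (le : le_pv rho tau).
Context (Hpsi : first_increase tau psi).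

(** If the sum had a larger value than the minimum, both terms would have the same value [rho a].
    But [tau] raises the value of [h * psi] and fixes that of [a], so [tau] of the sum would be
    [rho a], which is less than [rho] of the sum. *)
Lemma first_increase_expansion (a h : {poly K}) : (size a < size psi)%N ->
  rho (a + h * psi) = mine (rho a) (rho h + rho psi)%E.
Proof.
move=> sa; have [_ _ psilt eqt] := Hpsi.
have D := pvD prho a (h * psi); rewrite (pvM prho h) in D.
apply/le_anti/andP; split => //; rewrite leNgt; apply/negP => lt.
have [lt1|lt1|e] := ltgtP (rho a) (rho h + rho psi)%E.
- by move: lt; rewrite pvD_ltl ?pvM // min_l ?ltxx // ltW.
- by move: lt; rewrite pvD_ltr ?pvM // min_r ?ltxx // ltW.
move: lt; rewrite -e minxx => lt.
have afin : rho a \is a fin_num.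
  by rewrite pv_fin // (lt_le_trans lt) ?leey.
have hfin : rho h \is a fin_num.
  by move: afin; rewrite e fin_numD => /andP[].
have ta : tau a = rho a by rewrite eqt.
have : (tau a < tau (h * psi)%R)%E.
  by rewrite ta e pvM // (lt_le_trans _ (leeD2r _ (le h))) // lteD2lE.
by move=> /(pvD_ltl ptau) E; have := lt_le_trans lt (le _); rewrite E ta ltxx.
Qed.

Lemma first_increase_divp g :
  rho g = mine (rho (g %% psi)) (rho (g %/ psi) + rho psi)%E.
Proof.
have [mpsi _ _ _] := Hpsi.
by rewrite {1}(divp_eq g psi) addrC first_increase_expansion // ltn_modpN0 //
  monic_neq0.
Qed.

(** The part of [g] divisible by [psi] always has [tau]-value above a finite [rho g]. So the
    remainder decides, and on it [rho] and [tau] agree. *)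
Lemma lt_first_increase g : (rho g < tau g)%E <-> (rho g < rho (g %% psi)%R)%E.
Proof.
have [mpsi _ psilt eqt] := Hpsi.
have E := first_increase_divp g.
have eq0 : rho (g %% psi) = tau (g %% psi).
  by rewrite eqt // ltn_modpN0 // monic_neq0.
have L : (rho g < +oo -> rho g < tau (g %/ psi * psi)%R)%E.
  move=> gy; rewrite (pvM ptau).
  (* A pseudo-valuation [rho] may be infinite on a non-zero quotient; then [tau] is infinite there
     as well. *)
  have [hy|hy] := eqVneq (rho (g %/ psi)) +oo%E.
    have := le (g %/ psi); rewrite hy leye_eq => /eqP ->.
    by rewrite addye ?pvNy.
  have hfin : rho (g %/ psi) \is a fin_num by rewrite pv_fin // ltey.
  rewrite (@le_lt_trans _ _ (rho (g %/ psi) + rho psi)%E) //.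
    by rewrite E ge_min lexx orbT.
  by rewrite (lt_le_trans _ (leeD2r _ (le _))) // lteD2lE.
split=> lt.
  rewrite lt_neqAle E ge_min lexx andbT -E; apply/eqP => e.
  have gy : (rho g < +oo)%E by apply: lt_le_trans lt (leey _).
  move: lt; rewrite {2}(divp_eq g psi) pvD_ltr // -eq0 -e ?ltxx //.
  exact: L.
have gy : (rho g < +oo)%E by apply: lt_le_trans lt (leey _).
by rewrite {2}(divp_eq g psi) (pv_gtD ptau) ?L // -eq0.
Qed.

End Increase.

(** A polynomial of least degree with increasing value is divided by its leading coefficient.
    Agreement on constants makes its degree positive, and finiteness on constants keeps the
    inequality strict. *)
Lemma first_increase_exists_of_eq_const (tau : {poly K} -> \bar rat) :
  (forall c : K, rho c%:P = tau c%:P) ->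
  (forall c : K, c != 0 -> rho c%:P \is a fin_num) ->
  pseudo_valuation_axioms tau ->
  lt_pv rho tau -> exists psi, first_increase tau psi.
Proof.
move=> eqc finc ptau lt; have [le _] := lt.
have [g0 g0P] := lt_pv_witness lt.
have ex : exists n, `[< exists2 g : {poly K}, size g = n & (rho g < tau g)%E >].
  by exists (size g0); apply/asboolP; exists g0.
case: (ex_minnP ex) => n /asboolP[g sg glt] nmin.
have g_n0 : g != 0 by apply: contraTneq glt => ->; rewrite !pv0.
have lc0 : (lead_coef g)^-1 != 0 by rewrite invr_eq0 lead_coef_eq0.
have sE : size ((lead_coef g)^-1 *: g) = size g by rewrite size_scale.
exists ((lead_coef g)^-1 *: g); split.
- by rewrite monicE lead_coefZ mulVf // lead_coef_eq0.
- rewrite sE ltnNge; apply/negP => /size1_polyC ge.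
  by move: glt; rewrite ge eqc ltxx.
- by rewrite -mul_polyC !pvM // -eqc lteD2lE // finc.
- move=> h; rewrite sE sg => hn; apply/le_anti; rewrite le leNgt /=.
  apply/negP => hl; have : (n <= size h)%N by apply/nmin/asboolP; exists h.
  by rewrite leqNgt hn.
Qed.

End MinimalPolynomial.

(** * Preparations: finite sets of degrees and value groups *)

Lemma seq_least (s : seq rat) x : x \in s ->
  exists2 a, a \in s & forall b, b \in s -> a <= b.
Proof.
elim: s x => // y [|z s] IH x _.
  by exists y => [|b]; rewrite inE // => /eqP ->.
have [a as_ amin] := IH z (mem_head z s).
exists (Num.min y a) => [|b]; rewrite inE.
  by rewrite minEle; case: ifP => _; rewrite ?eqxx ?as_ ?orbT.
by case/orP=> [/eqP ->|/amin ab]; rewrite ge_min ?lexx // ab orbT.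
Qed.

Section Pval.
Context (K : fieldType) (v : K -> \bar rat) (mu : discval v).

Lemma pval_axioms : pseudo_valuation_axioms (pval mu).
Proof.
by split; [exact: pvalN1 | exact: pval0 | exact: pval1 | exact: pvalM |
  exact: pvalD].
Qed.

Lemma pvalC c : pval mu c%:P = v c. Proof. exact: discval_ext. Qed.

Lemma value_groupN a : value_group mu a -> value_group mu (- a).
Proof.
move=> [f f0 fa]; exists f^-1; first by rewrite invr_eq0.
case: (discvalP mu) => -[ny _ w1 wM _] _.
have : (mu f + mu (f^-1)%R = 0)%E by rewrite -wM mulfV.
rewrite fa; case: (mu (f^-1)) (ny (f^-1)) => // r _ [] /eqP.
by rewrite addr_eq0 => /eqP ->; rewrite opprK.
Qed.

Lemma value_groupB a b :
  value_group mu a -> value_group mu b -> value_group mu (a - b).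
Proof. by move=> ga gb; apply: value_groupD => //; apply: value_groupN. Qed.

End Pval.

(** * The polynomial of first increase is a key polynomial *)

Section KeyPolynomial.
Context (K : fieldType) (v : K -> \bar rat) (rho : discval v).
Context (tau : {poly K} -> \bar rat) (ptau : pseudo_valuation_axioms tau).
Context (le : le_pv (pval rho) tau) (psi : {poly K}).
Context (Hpsi : first_increase (pval rho) tau psi).

Let prho : pseudo_valuation_axioms (pval rho) := pval_axioms rho.

Let psi0 : psi != 0. Proof. by case: Hpsi => /monic_neq0. Qed.

Let r : rat := fine (pval rho psi).

Let rE : pval rho psi = r%:E.
Proof. by rewrite fineK // pval_fin. Qed.

(* The kernel of the map that [rho <= tau] induces on graded algebras; it turns
   out to be the ideal of [psi]. *)
Definition vanishing (s : hsum rho) :=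
  forall alpha, (alpha%:E < tau (component alpha s))%E.

Lemma homogeneous_component (s : hsum rho) alpha :
  (alpha%:E <= pval rho (component alpha s))%E.
Proof.
rewrite /component big_seq_cond; elim/big_ind: _ => [|a b Ha Hb|p].
- by rewrite pval0 leey.
- by apply: le_trans (pvalD _ _ _); rewrite le_min Ha.
- case/andP=> ps /eqP <-; case: s ps => s /= /allP H /H.
  by case/andP.
Qed.

Lemma component_out (s : hsum rho) alpha :
  alpha \notin map fst s -> component alpha s = 0.
Proof.
move=> ns; rewrite /component big_seq_cond big1 // => p /andP[ps /eqP e].
by move: ns; rewrite -e map_f.
Qed.

Lemma component_hsum_value (s : hsum rho) alpha :
  alpha \in map fst s -> value_group rho alpha.
Proof.
by case/mapP=> p; case: s => s /= /allP H /H /andP[/asboolP + _] ->.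
Qed.

Lemma component_initial_form_mul (c : hsum rho) (g : {poly K})
    (Hg : g != 0) alpha :
  component alpha (hsum_mul (HSum (initial_form_subproof rho g)) c) =
  g * component (alpha - fine (pval rho g)) c.
Proof. by rewrite component_mulr /= (negPf Hg) big_seq1. Qed.

(** Multiples of [psi] vanish because [tau psi] exceeds [rho psi]. Conversely, each component is
    divided by [psi], and the remainder lies in higher value. *)
Lemma vanishing_dvd (s : hsum rho) :
  divides (initial_form rho psi) (\pi_(gr rho) s) <-> vanishing s.
Proof.
split=> [[c]|Hs].
  elim/grW: c => c; rewrite [_ * _]gr_mulC [gr_mul _ _]pi_gr_mul =>
    /pi_grP H alpha.
  rewrite -(subrK (component alpha
    (hsum_mul (HSum (initial_form_subproof rho psi)) c)) (component alpha s)).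
  apply: pv_gtD => //; first exact: lt_le_trans (H alpha) (le _).
  rewrite component_initial_form_mul // (pvM ptau) -/r.
  have -> : alpha%:E = (r%:E + (alpha - r)%:E)%E
    by rewrite -EFinD [_ + (_ - _)]addrC subrK.
  rewrite lte_leD //; first by case: Hpsi => _ _; rewrite rE.
  exact: le_trans (homogeneous_component _ _) (le _).
(* The cofactor has the component [component alpha s %/ psi] in degree [alpha - r]. With [undup]
   each degree occurs once, since a component already sums all terms of its degree. *)
have Hc : all (homogeneous rho)
    [seq (alpha - r, component alpha s %/ psi) | alpha <- undup (map fst s)].
  apply/allP => p /mapP[alpha];
    rewrite mem_undup => /component_hsum_value va ->.
  apply/andP; split=> /=.
    apply/asboolP; apply: value_groupB => //.
    by exists (tofrac psi); rewrite ?tofrac_eq0.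
  rewrite EFinB leeBlDr // -rE (le_trans (homogeneous_component s alpha)) //.
  by rewrite (first_increase_divp prho ptau le Hpsi) ge_min lexx orbT.
exists (\pi_(gr rho) (HSum Hc)).
rewrite [_ * _]gr_mulC [gr_mul _ _]pi_gr_mul; apply/pi_grP => alpha.
rewrite component_initial_form_mul // -/r.
have -> : component (alpha - r) (HSum Hc) = component alpha s %/ psi.
  rewrite {1}/component big_map /=.
  under eq_bigl do rewrite (can_eq (subrK _)).
  have [as_|nas] := boolP (alpha \in map fst s).
    rewrite -big_filter filter_pred1_uniq ?undup_uniq ?mem_undup //.
    by rewrite big_seq1.
  rewrite big_seq_cond big1 ?(component_out nas) ?div0p // => a.
  by rewrite mem_undup => /andP[+ /eqP aa]; rewrite aa (negPf nas).
rewrite {1}(divp_eq (component alpha s) psi) mulrC addrC addKr.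
(* If the component has value exactly [alpha], then [tau] increases it, so its remainder has larger
   value. Otherwise its value is already above [alpha], and the remainder is not below it. *)
have := homogeneous_component s alpha.
rewrite le_eqVlt => /orP[/eqP e|lt].
  rewrite e; apply/(lt_first_increase prho ptau le Hpsi).
  by rewrite -e.
apply: lt_le_trans lt _.
by rewrite (first_increase_divp prho ptau le Hpsi) ge_min lexx.
Qed.

(** Degrees outside the list have zero component and hence infinite [tau], so a least bad degree is
    found among finitely many. *)
Lemma least_nonvanishing (s : hsum rho) : ~ vanishing s ->
  exists alpha, ~ (alpha%:E < tau (component alpha s))%E /\
    forall beta, beta < alpha -> (beta%:E < tau (component beta s))%E.
Proof.
move=> /existsNP[a0 Ha0].
pose bad := [seq a <- map fst s | ~~ (a%:E < tau (component a s))%E].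
have mem_bad a : ~~ (a%:E < tau (component a s))%E -> a \in bad.
  move=> Ha; rewrite mem_filter Ha; apply: contraNT Ha => /component_out ->.
  by rewrite pv0 // ltry.
have : a0 \in bad by apply: mem_bad; apply/negP.
case/seq_least=> a; rewrite mem_filter => /andP[/negP Ha _] amin.
exists a; split=> // b; rewrite ltNge => ab; apply: contraNT ab.
by move=> /mem_bad /amin.
Qed.

(** Grouping the terms of [s] by degree allows one product of components to be split off in
    [vanishing_mul]. *)
Lemma component_mul_degrees (s t : hsum rho) alpha :
  component alpha (hsum_mul s t) =
  \sum_(beta <- undup (map fst s))
    component beta s * component (alpha - beta) t.
Proof.
rewrite component_mulr /component.
under [RHS]eq_bigr do rewrite mulr_suml.
rewrite (exchange_big_dep xpredT) //= big_seq [RHS]big_seq.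
apply: eq_bigr => p ps.
rewrite (eq_bigl (pred1 p.1)) => [|b]; last by rewrite /= eq_sym.
rewrite -[RHS]big_filter filter_pred1_uniq ?undup_uniq ?mem_undup ?map_f //.
by rewrite big_seq1.
Qed.

(** As in the Gauss lemma: if [a] and [b] are the least non-vanishing degrees, then in degree
    [a + b] the product of these two components has [tau]-value [a + b], and every other product has
    a larger one. *)
Lemma vanishing_mul (s t : hsum rho) :
  vanishing (hsum_mul s t) -> vanishing s \/ vanishing t.
Proof.
move=> Hst; apply: contrapT => /not_orP[/least_nonvanishing[a [Ha la]]].
move=> /least_nonvanishing[b [Hb lb]].
have {}Ha : tau (component a s) = a%:E.
  apply/le_anti; rewrite (le_trans (homogeneous_component _ _) (le _)) andbT.
  by rewrite leNgt; apply/negP.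
have {}Hb : tau (component b t) = b%:E.
  apply/le_anti; rewrite (le_trans (homogeneous_component _ _) (le _)) andbT.
  by rewrite leNgt; apply/negP.
have main : tau (component a s * component b t) = (a + b)%:E.
  by rewrite pvM // Ha Hb.
have := Hst (a + b); rewrite component_mul_degrees.
have as_ : a \in undup (map fst s).
  rewrite mem_undup; apply: contraPT Ha => /component_out ->.
  by rewrite (pv0 ptau).
rewrite (bigD1_seq a) ?undup_uniq //= addrAC subrr add0r.
rewrite (pvD_ltl ptau) main ?ltxx //.
apply: pv_gt_sum => // [|c ca]; first exact: ltry.
rewrite (pvM ptau).
have -> : ((a + b)%:E = c%:E + (a + b - c)%:E)%E by rewrite -EFinD [_ + (_ -
  _)]addrC subrK.
have cs := le_trans (homogeneous_component s c) (le _).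
have ct := le_trans (homogeneous_component t (a + b - c)) (le _).
have [ltca|ltac|/eqP] := ltgtP c a; last by rewrite (negPf ca).
  by rewrite lte_leD // la.
by rewrite lee_ltD // lb // ltrBlDr addrC ltrD2l.
Qed.

(** Divisibility by the initial form is tested by [vanishing]: it fails for [1], it is prime by
    [vanishing_mul], and it fails in degrees below that of [psi], where [tau] equals [rho]. *)
Lemma first_increase_key_polynomial : key_polynomial rho psi.
Proof.
have [mpsi spsi psilt eqt] := Hpsi; split=> //.
- apply/eqP => /pi_grP /(_ r).
  rewrite component_zero subr0 /component /= (negPf psi0) big_mkcond big_seq1
    eqxx.
  by rewrite rE ltxx.
- have dvdP (x : gr rho) : (x \in principal_ideal (initial_form rho psi)) =
     `[< divides (initial_form rho psi) x >] by [].
  split; first split.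
  + by rewrite dvdP; apply/asboolP; exists 0; rewrite mul0r.
  + rewrite dvdP; apply/asboolP => /(vanishing_dvd (hsum_one rho)) /(_ 0).
    by rewrite /component big_mkcond big_seq1 eqxx (pv1 ptau) ltxx.
  + move=> a x y; rewrite !dvdP => /asboolP[c ->] /asboolP[d ->]; apply/asboolP.
    by exists (a * c + d); rewrite mulrDl mulrA.
  elim/grW=> s; elim/grW=> t; rewrite !dvdP [_ * _]pi_gr_mul => /asboolP.
  by case/vanishing_dvd/vanishing_mul => H; apply/orP; [left|right];
    apply/asboolP/vanishing_dvd.
- move=> g g0 sg /vanishing_dvd /(_ (fine (pval rho g))).
  rewrite /component /= (negPf g0) big_mkcond big_seq1 eqxx -eqt //.
  by rewrite fineK ?pval_fin // ltxx.
Qed.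

End KeyPolynomial.

(** * Valuations defined by expansions in a monic polynomial *)

Lemma mineDr (x y : \bar rat) (c : rat) :
  (mine x y + c%:E = mine (x + c%:E) (y + c%:E))%E.
Proof. by rewrite !minEle leeD2rE //; case: ifP. Qed.

(* [w] on polynomials of degree below [deg phi] is extended by
   [sum_s a_s phi^s |-> min_s (w a_s + s gam)]. *)
Section ExpansionValuation.
Context (K : fieldType) (phi : {poly K}) (w : {poly K} -> \bar rat) (gam : rat).
Context (mphi : phi \is monic) (sphi : (1 < size phi)%N).

Lemma expansion_ind (P : {poly K} -> Prop) : P 0 ->
  (forall a h : {poly K}, (size a < size phi)%N -> P h -> P (h * phi + a)) ->
  forall g, P g.
Proof.
move=> P0 PS g; have [n] := ubnP (size g); elim: n g => // n IH g sg.
have [->//|g0] := eqVneq g 0.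
rewrite (divp_eq g phi); apply: PS; first by rewrite ltn_modpN0 // monic_neq0.
by apply: IH; rewrite (leq_trans (ltn_divpl_size mphi g0 sphi)).
Qed.

(** Here [n] bounds the recursion depth, as a quotient is not a structural subterm. By
    [expansion_val_recE] every bound at least [size g] gives the same value. *)
Fixpoint expansion_val_rec n (g : {poly K}) : \bar rat :=
  if n is n'.+1 then
    if g == 0 then +oo%E
    else mine (w (g %% phi)) (expansion_val_rec n' (g %/ phi) + gam%:E)%E
  else +oo%E.

Definition expansion_val (g : {poly K}) := expansion_val_rec (size g) g.
Local Notation W := expansion_val.

Context (w0 : w 0 = +oo%E).

Lemma expansion_val0 : W 0 = +oo%E. Proof. by rewrite /W size_poly0. Qed.

Lemma expansion_val_recE n (g : {poly K}) : (size g <= n)%N ->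
  expansion_val_rec n g = W g.
Proof.
rewrite /W => sn; move: (leqnn (size g)); move: {2 3}(size g) => m.
elim: n m g sn => [|n IH] [|m] g //=.
- by rewrite leqn0 size_poly_eq0 => ->.
- by rewrite leqn0 size_poly_eq0 => _ ->.
move=> sn sm; have [//|g0] := eqVneq g 0.
have sd := ltn_divpl_size mphi g0 sphi.
by rewrite (IH m) // -ltnS (leq_trans sd).
Qed.

Lemma expansion_valE (h a : {poly K}) : (size a < size phi)%N ->
  W (h * phi + a) = mine (w a) (W h + gam%:E)%E.
Proof.
move=> sa; set g := h * phi + a.
have ga : g %% phi = a by rewrite /g modpD modp_mull add0r modp_small.
have gh : g %/ phi = h.
  by rewrite /g divpD mulpK ?monic_neq0 // divp_small // addr0.
have [g0|g0] := eqVneq g 0.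
  have a0 : a = 0 by rewrite -ga g0 mod0p.
  have h0 : h = 0 by rewrite -gh g0 div0p.
  by rewrite g0 a0 h0 expansion_val0 w0.
have sd := ltn_divpl_size mphi g0 sphi.
rewrite {1}/W; case: (size g) (sd) (erefl (size g)) => // n sn _ /=.
by rewrite (negPf g0) expansion_val_recE // ga gh.
Qed.

Lemma expansion_val_small (a : {poly K}) : (size a < size phi)%N -> W a = w a.
Proof.
move=> sa; have := expansion_valE 0 sa.
by rewrite mul0r add0r expansion_val0 addye // min_l ?leey.
Qed.

Lemma expansion_val_phi h : W (h * phi) = (W h + gam%:E)%E.
Proof.
have := @expansion_valE h 0; rewrite addr0 size_poly0 => -> //; last first.
  exact: ltn_trans sphi.
by rewrite w0 min_r ?leey.
Qed.

Lemma expansion_val_mod g : (W g <= w (g %% phi)%R)%E.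
Proof.
have s : (size (g %% phi)%R < size phi)%N by rewrite ltn_modpN0 // monic_neq0.
by rewrite {1}(divp_eq g phi) expansion_valE // ge_min lexx.
Qed.

Lemma expansion_val_sum n (g : 'I_n -> {poly K}) :
  (forall s, size (g s) < size phi)%N ->
  W (\sum_(s < n) g s * phi ^+ s) =
  \big[mine/+oo%E]_(s < n) (w (g s) + (gam *+ s)%:E)%E.
Proof.
elim: n g => [|n IH] g sg; first by rewrite !big_ord0 expansion_val0.
rewrite !big_ord_recl /= expr0 mulr1 mulr0n adde0.
have -> : \sum_(i < n) g (lift ord0 i) * phi ^+ bump 0 i =
    (\sum_(i < n) g (lift ord0 i) * phi ^+ i) * phi.
  by rewrite mulr_suml; apply: eq_bigr => i _; rewrite /bump add1n exprSr mulrA.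
rewrite addrC expansion_valE // IH //; congr mine.
rewrite (big_morph (fun x => x + gam%:E)%E (id1 := +oo%E) (op1 := mine)) //.
  by apply: eq_bigr => i _; rewrite -addeA -EFinD /bump add1n mulrSr.
by move=> x y; rewrite mineDr.
Qed.

(** This serves to exclude [-oo], and later to keep the values in a fixed cyclic group. *)
Lemma expansion_val_prop (P : \bar rat -> Prop) :
  P +oo%E -> (forall x y, P x -> P y -> P (mine x y)) ->
  (forall x, P x -> P (x + gam%:E)%E) ->
  (forall a : {poly K}, (size a < size phi)%N -> P (w a)) ->
  forall g, P (W g).
Proof.
move=> Py Pm Pg Pw; apply: expansion_ind => [|a h sa Ph].
  by rewrite expansion_val0.
by rewrite expansion_valE //; apply: Pm; [exact: Pw | exact: Pg].
Qed.

Context (wfin : forall a : {poly K}, (size a < size phi)%N -> a != 0 ->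
  w a \is a fin_num).

Lemma expansion_val_fin g : g != 0 -> W g \is a fin_num.
Proof.
elim/expansion_ind: g => [|a h sa IH]; first by rewrite eqxx.
rewrite expansion_valE //.
have [->|h0] := eqVneq h 0.
  rewrite mul0r add0r expansion_val0 addye // min_l ?leey //; exact: wfin.
have hf : (W h + gam%:E)%E \is a fin_num by rewrite fin_numD IH.
have [->|a0] := eqVneq a 0; first by rewrite w0 min_r ?leey.
by move=> _; rewrite minEle; case: ifP => // _; apply: wfin.
Qed.

Context (wNy : forall a, w a != -oo%E).
Context (w1 : w 1 = 0%E) (wN : forall a, w (- a) = w a).
Context (wD : forall a b, (mine (w a) (w b) <= w (a + b)%R)%E).
(* With [a b = c + e phi], these say that [w c = w a + w b <= w e + gam]. *)
Context (wM : forall a b : {poly K}, (size a < size phi)%N ->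
  (size b < size phi)%N ->
  w ((a * b) %% phi) = (w a + w b)%E).
Context (wMdiv : forall a b : {poly K}, (size a < size phi)%N ->
  (size b < size phi)%N ->
  (w a + w b <= w ((a * b) %/ phi)%R + gam%:E)%E).

Lemma expansion_valNy g : W g != -oo%E.
Proof.
apply: (@expansion_val_prop (fun x => x != -oo%E)) => // [x y xN yN|x].
  by rewrite minEle; case: ifP.
by case: x.
Qed.

Lemma expansion_valN g : W (- g) = W g.
Proof.
elim/expansion_ind: g => [|a h sa IH]; first by rewrite oppr0.
by rewrite opprD -mulNr !expansion_valE ?size_polyN // IH wN.
Qed.

Lemma expansion_valD g g' : (mine (W g) (W g') <= W (g + g')%R)%E.
Proof.
elim/expansion_ind: g g' => [|a h sa IH] g'.
  by rewrite add0r ge_min lexx orbT.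
have sb : (size (g' %% phi)%R < size phi)%N by rewrite ltn_modpN0 // monic_neq0.
rewrite (divp_eq g' phi); set h' := g' %/ phi; set b := g' %% phi.
rewrite addrACA -mulrDl !expansion_valE //; last first.
  by rewrite (leq_ltn_trans (size_polyD _ _)) // gtn_max sa.
rewrite le_min; apply/andP; split.
  by apply: le_trans (wD a b); rewrite le_min !ge_min !lexx /= !orbT.
apply: le_trans (leeD2r gam%:E (IH h')); rewrite mineDr le_min.
by rewrite !ge_min !lexx /= !orbT.
Qed.

Lemma expansion_valD_ltl g g' : (W g < W g')%E -> W (g + g') = W g.
Proof. exact: (nonarchimedean_ltl expansion_valD expansion_valN). Qed.

Lemma size_mul_div_small (a b : {poly K}) : (size a < size phi)%N ->
  (size b < size phi)%N -> (size ((a * b) %/ phi)%R < size phi)%N.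
Proof.
move=> sa sb; rewrite size_divp ?monic_neq0 //.
have := size_polyMleq a b; move: sa sb sphi.
by move: (size (a * b)%R) (size a) (size b) (size phi) => k i j m; lia.
Qed.

Lemma expansion_valM_small_le (a b : {poly K}) : (size a < size phi)%N ->
  (size b < size phi)%N -> (w a + w b <= W (a * b)%R)%E.
Proof.
move=> sa sb; have s : (size ((a * b) %% phi)%R < size phi)%N.
  by rewrite ltn_modpN0 // monic_neq0.
rewrite (divp_eq (a * b) phi) expansion_valE // le_min wM // lexx /=.
by rewrite expansion_val_small ?wMdiv // size_mul_div_small.
Qed.

Lemma expansion_val_geD x g g' :
  (x <= W g)%E -> (x <= W g')%E -> (x <= W (g + g')%R)%E.
Proof. by move=> xg xg'; apply: le_trans (expansion_valD g g');
  rewrite le_min xg. Qed.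

(** Let [g = h * phi + b]. If [b] attains the minimum, the remainder of [a * b] bounds the value
    from above; otherwise [a * h * phi] has strictly the least value. *)
Lemma expansion_valM_small (a g : {poly K}) : (size a < size phi)%N ->
  W (a * g) = (w a + W g)%E.
Proof.
move=> sa; have [->|a0] := eqVneq a 0.
  by rewrite mul0r expansion_val0 w0 addye // expansion_valNy.
have afin := wfin sa a0.
elim/expansion_ind: g => [|b h sb IH].
  by rewrite mulr0 expansion_val0 addey.
have E1 : W (a * h * phi) = (w a + (W h + gam%:E))%E.
  by rewrite expansion_val_phi IH addeA.
have E2 := expansion_valM_small_le sa sb.
rewrite expansion_valE // mulrDr mulrA.
have [le|lt] := leP (w b) (W h + gam%:E)%E.
  apply/le_anti/andP; split.
    apply: le_trans (expansion_val_mod _) _.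
    by rewrite modpD modp_mull add0r wM.
  by rewrite expansion_val_geD // E1 leeD2l.
by rewrite expansion_valD_ltl E1 // (lt_le_trans _ E2) // lteD2lE.
Qed.

(** If in one factor the multiple of [phi] has strictly smaller value than the constant term, it
    also dominates in the product; this is [aux]. Otherwise both constant terms attain the minimum,
    and the remainder of their product gives the upper bound. *)
Lemma expansion_valM g g' :
  W (g * g') = (W g + W g')%E.
Proof.
elim/expansion_ind: g g' => [|a h sa IHg] g'.
  by rewrite mul0r expansion_val0 addye ?expansion_valNy.
elim/expansion_ind: g' => [|b h' sb IHg'].
  by rewrite mulr0 expansion_val0 addey ?expansion_valNy.
have Wfin := expansion_val_fin.
have aux (a0 h0 g0 : {poly K}) : (size a0 < size phi)%N ->
    W (h0 * g0) = (W h0 + W g0)%E -> (W h0 + gam%:E < w a0)%E ->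
  W ((h0 * phi + a0) * g0) = (W (h0 * phi + a0)%R + W g0)%E.
  move=> sa0 E lt; have [->|g00] := eqVneq g0 0.
    by rewrite mulr0 expansion_val0 addey ?expansion_valNy.
  have E1 : W (h0 * phi * g0) = (W h0 + gam%:E + W g0)%E.
    by rewrite mulrAC expansion_val_phi E addeAC.
  rewrite expansion_valE // (min_r (ltW lt)) mulrDl expansion_valD_ltl E1 //.
  by rewrite expansion_valM_small // lteD2rE // Wfin.
have [lea|] := leP (w a) (W h + gam%:E)%E; last exact: aux.
have [leb|lt] := leP (w b) (W h' + gam%:E)%E; last first.
  by rewrite mulrC [RHS]addeC aux // mulrC IHg' addeC.
apply/le_anti/andP; split.
  apply: le_trans (expansion_val_mod _) _.
  rewrite mulrDr mulrA modpD modp_mull add0r mulrDl modpD mulrAC modp_mull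
    add0r.
  by rewrite wM // !expansion_valE // !min_l.
rewrite mulrDl expansion_val_geD //.
  by rewrite mulrAC expansion_val_phi IHg addeAC leeD2r // expansion_valE //
    ge_min lexx orbT.
by rewrite expansion_valM_small // leeD2r // expansion_valE // ge_min lexx.
Qed.

Lemma expansion_val_axioms :
  pseudo_valuation_axioms W.
Proof.
split=> [g| | |g g'|g g'].
- exact: expansion_valNy.
- exact: expansion_val0.
- by rewrite expansion_val_small ?w1 // size_poly1.
- exact: expansion_valM.
- exact: expansion_valD.
Qed.

End ExpansionValuation.

(** * Extension to the fraction field, with cyclic value group *)

(** If some [d *+ k] with [k > 0] lies in [G], the least such [k] gives a generator by division with
    remainder; otherwise [G] is zero. *)
Lemma cyclic_subgroup (G : rat -> Prop) (d : rat) : G 0 ->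
  (forall a b, G a -> G b -> G (a - b)) ->
  (forall a, G a -> exists n : int, a = d *~ n) -> cyclic_group G.
Proof.
move=> G0 GB GZ.
have GN a : G a -> G (- a) by rewrite -sub0r; exact: GB.
have GD a b : G a -> G b -> G (a + b) by rewrite -{2}[b]opprK => Ga /GN;
  exact: GB.
have Gnat a n : G a -> G (a *+ n).
  by move=> Ga; elim: n => // n IH; rewrite mulrS; exact: GD.
have Gint a (n : int) : G a -> G (a *~ n).
  by case: n => n Ga; [exact: Gnat | rewrite NegzE mulrNz; exact/GN/Gnat].
have [ex|nex] := pselect (exists k, `[< (0 < k)%N /\ G (d *+ k) >]); last first.
  exists 0 => a; split=> [Ga|[n ->]]; last by rewrite mul0rz.
  exists 0; rewrite mulr0z; have [n an] := GZ a Ga.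
  rewrite an; apply: contrapT => dn0; apply: nex; exists `|n|%N; apply/asboolP;
    split.
    by rewrite absz_gt0; apply: contra_notN dn0 => /eqP ->; rewrite mulr0z.
  move: Ga; rewrite an; case: n {an dn0} => n //.
  by rewrite NegzE mulrNz => /GN; rewrite opprK.
case: (ex_minnP ex) => k /asboolP[k0 Gk] kmin.
exists (d *+ k) => a; split=> [Ga|[n ->]]; last exact: Gint.
have [n an] := GZ a Ga.
exists (n %/ k)%Z; rewrite an pmulrn -mulrzA {1}(divz_eq n k) mulrC.
suff -> : (n %% k)%Z = 0 by rewrite addr0.
have : (0 <= (n %% k)%Z < k) by rewrite modz_ge0 ?ltz_pmod // -lt0n.
have : G (d *~ (n %% k)%Z).
  have -> : d *~ (n %% k)%Z = a - (d *+ k) *~ (n %/ k)%Z.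
    by rewrite an pmulrn -mulrzA -mulrzBr {2}(divz_eq n k) [_ * k%:Z]mulrC
      addrAC subrr add0r.
  by apply: GB => //; exact: Gint.
case: (n %% k)%Z => // r Gr /andP[_]; rewrite ltz_nat => rk.
case: (posnP r) => [->//|r0].
have /kmin : `[< (0 < r)%N /\ G (d *+ r) >] by apply/asboolP.
by rewrite leqNgt rk.
Qed.

Lemma fraction_quotient (R : idomainType) (x : {fraction R}) :
  exists p : R * R, p.2 != 0 /\ x = tofrac p.1 / tofrac p.2.
Proof.
elim/quotW: x => -[[n d] /= d0]; exists (n, d); split=> //=.
have td0 : tofrac d != 0 by rewrite tofrac_eq0.
apply: (canRL (mulfK td0)); rewrite !piE; apply/eqmodP => /=.
rewrite FracField.equivfE /FracField.mulf !numden_Ratio ?oner_neq0 ?mulf_neq0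
  //.
- by rewrite !mulr1 mulrC.
- exact: oner_neq0.
- exact: oner_neq0.
Qed.

Section FractionExtension.
Context (R : idomainType) (w : R -> \bar rat).
Context (pw : pseudo_valuation_axioms w).
Context (wfin : forall a, a != 0 -> w a \is a fin_num).

(** The numerator and denominator are picked by choice; [fraction_valE] shows that the value does
    not depend on them. *)
Definition fraction_val (x : {fraction R}) : \bar rat :=
  let p := sval (cid (fraction_quotient x)) in (w p.1 - w p.2)%E.

Lemma fraction_valE n d : d != 0 ->
  fraction_val (tofrac n / tofrac d) = (w n - w d)%E.
Proof.
rewrite /fraction_val; set x := tofrac n / tofrac d.
case: (cid _) => -[n' d'] /= [d'0 E] d0.
have : tofrac n * tofrac d' = tofrac n' * tofrac d.
  move: E; rewrite /x => /(congr1 (fun y => y * (tofrac d * tofrac d'))).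
  rewrite mulrA divfK ?tofrac_eq0 // => ->.
  by rewrite [tofrac d * _]mulrC mulrA divfK ?tofrac_eq0.
rewrite -!rmorphM => /eqP; rewrite tofrac_eq => /eqP /(congr1 w);
  rewrite !(pvM pw).
have := wfin d0; have := wfin d'0; have := pvNy pw n; have := pvNy pw n'.
case: (w n) => [a| |]; case: (w n') => [a'| |]; case: (w d) => [b| |] //;
  case: (w d') => [b'| |] // _ _ _ _.
rewrite -!EFinD => -[ab]; congr EFin; apply/eqP.
by rewrite subr_eq addrAC eq_sym subr_eq ab.
Qed.

Lemma fraction_val_tofrac a : fraction_val (tofrac a) = w a.
Proof.
have := @fraction_valE a 1; rewrite rmorph1 divr1 => -> //.
  by rewrite (pv1 pw) sube0.
exact: oner_neq0.
Qed.

Lemma fraction_val_valuation : valuation fraction_val.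
Proof.
split; last first.
  move=> x; have [[n d] /= [d0 ->]] := fraction_quotient x => nd0.
  rewrite fraction_valE // fin_numB !wfin //.
  by apply: contra_neq nd0 => ->; rewrite rmorph0 mul0r.
have tf (d : R) : d != 0 -> tofrac d != 0 by rewrite tofrac_eq0.
split.
- move=> x; have [[n d] /= [d0 ->]] := fraction_quotient x.
  rewrite fraction_valE //; have := wfin d0; have := pvNy pw n.
  by case: (w n); case: (w d).
- by rewrite -(tofrac0 R) fraction_val_tofrac (pv0 pw).
- by rewrite -(tofrac1 R) fraction_val_tofrac (pv1 pw).
- move=> x y; have [[n d] /= [d0 ->]] := fraction_quotient x.
  have [[n' d'] /= [d'0 ->]] := fraction_quotient y.
  rewrite mulrACA -invfM -!rmorphM !fraction_valE ?mulf_neq0 // !(pvM pw).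
  by rewrite fin_num_oppeD ?wfin // addeACA.
move=> x y; have [[n d] /= [d0 ->]] := fraction_quotient x.
have [[n' d'] /= [d'0 ->]] := fraction_quotient y.
rewrite addf_div ?tf // -!rmorphM -rmorphD !fraction_valE ?mulf_neq0 //
  (pvM pw).
have df := wfin d0; have d'f := wfin d'0.
rewrite leeBrDr ?fin_numD ?df //.
apply: le_trans (pvD pw _ _); rewrite le_min !(pvM pw).
case: (w d) df => // r _; case: (w d') d'f => // r' _.
rewrite -EFinD mineDr !ge_min; apply/andP; split; apply/orP; [left|right].
  by case: (w n) (pvNy pw n) => // s _; rewrite lee_fin; lra.
by case: (w n') (pvNy pw n') => // s _; rewrite lee_fin; lra.
Qed.

End FractionExtension.

(** Values of non-zero fractions are differences of values of polynomials, so they stay among the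
    multiples of [d] and form a cyclic group. *)
Lemma discval_of_poly (K : fieldType) (v : K -> \bar rat)
    (w : {poly K} -> \bar rat) (d : rat) :
  pseudo_valuation v w -> (0 <= w 'X)%E ->
  (forall g, g != 0 -> exists n : int, w g = (d *~ n)%:E) ->
  exists rho : discval v, pval rho =1 w.
Proof.
move=> [pw ext] wX wZ.
have wfin g : g != 0 -> w g \is a fin_num by move=> /wZ[n ->].
have vF := fraction_val_valuation pw wfin.
have tF := fraction_val_tofrac pw wfin.
have cyc : cyclic_group (value_group (fraction_val w)).
  have [[ny F0 F1 FM _] Ffin] := vF.
  apply: (@cyclic_subgroup _ d).
  - by exists 1; [exact: oner_neq0 | exact: F1].
  - move=> a b [x x0 xa] [y y0 yb]; exists (x / y);
    first by rewrite mulf_neq0 ?invr_eq0.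
    have : fraction_val w (x / y * y) = a%:E by rewrite divfK.
    rewrite FM yb; case: (fraction_val w (x / y)) => // r [] <-.
    by rewrite addrK.
  move=> a [x x0 xa]; have [[n e] /= [e0 xE]] := fraction_quotient x.
  have n0 : n != 0 by apply: contra_neq x0 => n0; rewrite xE n0 rmorph0 mul0r.
  have [i wi] := wZ n n0; have [j wj] := wZ e e0.
  exists (i - j); move: xa; rewrite xE fraction_valE // wi wj => -[<-].
  by rewrite mulrzBr.
have extF a : fraction_val w (tofrac a%:P) = v a by rewrite tF ext.
have XF : (0 <= fraction_val w (tofrac 'X))%E by rewrite tF.
by exists (Discval vF cyc extF XF) => g; rewrite /pval /= tF.
Qed.

(** * Comparison of valuations along a first increase *)

(** As [rho] is the minimum over the terms of a [psi]-expansion, it suffices to compare at [psi] and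
    in smaller degrees. *)
Lemma first_increase_le (K : fieldType) (rho tau sigma : {poly K} -> \bar rat)
    (psi : {poly K}) :
  pseudo_valuation_axioms rho -> pseudo_valuation_axioms tau ->
  pseudo_valuation_axioms sigma -> le_pv rho tau ->
    first_increase rho tau psi ->
  (forall a : {poly K}, (size a < size psi)%N -> (rho a <= sigma a)%E) ->
  (rho psi <= sigma psi)%E -> le_pv rho sigma.
Proof.
move=> prho ptau psigma le Hpsi lea lepsi; have [mpsi spsi _ _] := Hpsi.
elim/(expansion_ind mpsi spsi) => [|a h sa IH]; first by rewrite !pv0.
rewrite addrC (first_increase_expansion prho ptau le Hpsi) //.
apply: le_trans (pvD psigma _ _); rewrite (pvM psigma) le_min !ge_min lea //=.
by rewrite leeD ?orbT.
Qed.

(** If [sigma psi] were [rho psi], then [psi] would be a first increase from [sigma] to [tau], and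
    [first_increase_le] would give [sigma <= rho]. *)
Lemma first_increase_between (K : fieldType) (rho sigma tau : {poly K} ->
  \bar rat)
    (psi : {poly K}) :
  pseudo_valuation_axioms rho -> pseudo_valuation_axioms sigma ->
  pseudo_valuation_axioms tau -> lt_pv rho sigma -> le_pv sigma tau ->
  first_increase rho tau psi -> first_increase rho sigma psi.
Proof.
move=> prho psigma ptau [le1 ne] le2 [mpsi spsi lt eqt].
have eqs (a : {poly K}) : (size a < size psi)%N -> rho a = sigma a.
  by move=> sa; apply/le_anti; rewrite le1 eqt //= le2.
split=> //; rewrite lt_neqAle le1 andbT; apply/eqP => e; apply: ne => g.
apply/le_anti; rewrite le1 /=.
apply: (@first_increase_le _ sigma tau rho psi) => //; last by rewrite e.
  by split=> // [|a sa]; [rewrite -e | rewrite -eqs // eqt].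
by move=> a sa; rewrite eqs.
Qed.

(** Both [rho f < sigma f] and [rho f < tau f] amount to the same condition on [rho] and the
    remainder of [f] modulo [psi]. *)
Lemma lt_pv_of_lt_above (K : fieldType) (rho sigma tau : {poly K} -> \bar rat)
    (psi f : {poly K}) :
  pseudo_valuation_axioms rho -> pseudo_valuation_axioms sigma ->
  pseudo_valuation_axioms tau -> lt_pv rho sigma -> le_pv sigma tau ->
  first_increase rho tau psi -> (sigma f < tau f)%E -> (rho f < sigma f)%E.
Proof.
move=> prho psigma ptau lt le Hpsi ltf.
have [le1 _] := lt.
have le2 : le_pv rho tau by move=> g; apply: le_trans (le g).
have Hpsi' := first_increase_between prho psigma ptau lt le Hpsi.
apply/(lt_first_increase prho psigma le1 Hpsi').
apply/(lt_first_increase prho ptau le2 Hpsi).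
exact: le_lt_trans (le1 f) ltf.
Qed.

(** * The augmentation that gives [psi] its value under [tau] *)

Section Augmentation.
Context (K : fieldType) (rho tau : {poly K} -> \bar rat) (psi : {poly K}).
Context (gam : rat).
Context (prho : pseudo_valuation_axioms rho).
Context (ptau : pseudo_valuation_axioms tau).
Context (le : le_pv rho tau) (Hpsi : first_increase rho tau psi).
Context (taupsi : tau psi = gam%:E).
Local Notation W := (expansion_val psi rho gam).

Let mpsi : psi \is monic. Proof. by case: Hpsi. Qed.
Let spsi : (1 < size psi)%N. Proof. by case: Hpsi. Qed.

Lemma augmented_axioms :
  (forall a, a != 0 -> rho a \is a fin_num) -> pseudo_valuation_axioms W.
Proof.
move=> fin; have [_ _ _ eqt] := Hpsi.
apply: expansion_val_axioms => //; first exact: pv0.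
- by move=> a _; exact: fin.
- exact: pvNy.
- exact: pv1.
- exact: pvN.
- exact: pvD.
(* A remainder of larger value would force [tau] to exceed [rho] at [a * b], but they agree at both
   factors. *)
- move=> a b sa sb; rewrite -(pvM prho).
  apply/le_anti/andP; split; last first.
    by rewrite {1}(first_increase_divp prho ptau le Hpsi) ge_min lexx.
  rewrite leNgt; apply/negP => /(lt_first_increase prho ptau le Hpsi).
  by rewrite (pvM prho) (pvM ptau) !eqt // ltxx.
- move=> a b sa sb; rewrite -(pvM prho).
  rewrite {1}(first_increase_divp prho ptau le Hpsi) ge_min; apply/orP; right.
  by rewrite leeD2l // -taupsi.
Qed.

Lemma augmented_ge : le_pv rho W.
Proof.
elim/(expansion_ind mpsi spsi) => [|a h sa IH].
  by rewrite expansion_val0 leey.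
rewrite expansion_valE ?(pv0 prho) //
  addrC (first_increase_expansion prho ptau le Hpsi) //.
by rewrite le_min !ge_min lexx /= leeD ?orbT // -taupsi.
Qed.

Lemma augmented_le : le_pv W tau.
Proof.
have [_ _ _ eqt] := Hpsi.
elim/(expansion_ind mpsi spsi) => [|a h sa IH].
  by rewrite (pv0 ptau) leey.
rewrite expansion_valE ?(pv0 prho) // [_ * _ + _]addrC;
  apply: le_trans (pvD ptau _ _).
rewrite le_min !ge_min eqt // lexx /= (pvM ptau) taupsi.
by rewrite leeD2r ?orbT.
Qed.

(** The remainder of [f] exceeds [rho f], so the quotient term alone attains the minimum, and it is
    raised because [gam] exceeds [rho psi]. *)
Lemma augmented_gt f : (rho f < tau f)%E -> (rho f < W f)%E.
Proof.
move=> lt; have ltm := (lt_first_increase prho ptau le Hpsi f).1 lt.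
have E := first_increase_divp prho ptau le Hpsi f.
have sm : (size (f %% psi)%R < size psi)%N by rewrite ltn_modpN0 // monic_neq0.
rewrite [X in expansion_val _ _ _ X](divp_eq f psi) expansion_valE ?(pv0 prho)
  //.
rewrite lt_min ltm /=.
have e : rho f = (rho (f %/ psi) + rho psi)%E.
  have [le1|/ltW le1] := leP (rho (f %% psi)) (rho (f %/ psi) + rho psi)%E.
    by move: ltm; rewrite {1}E min_l // ltxx.
  by rewrite E min_r.
rewrite e (lt_le_trans _ (leeD2r _ (augmented_ge _))) //.
rewrite lteD2lE; first by rewrite -taupsi; case: Hpsi.
have : rho f \is a fin_num.
  by apply: pv_fin => //; apply: lt_le_trans lt (leey _).
by rewrite e fin_numD => /andP[].
Qed.

End Augmentation.

(** An augmentation is given by the increment over the old value of [psi], whereas [gam] is the new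
    value itself. *)
Lemma expansion_val_augmentation (K : fieldType) (v : K -> \bar rat)
    (rho rho' : discval v)
    (psi : {poly K}) (gam : rat) : psi \is monic -> (1 < size psi)%N ->
  pval rho' =1 expansion_val psi (pval rho) gam ->
  augmentation rho psi (gam - fine (pval rho psi)) rho'.
Proof.
move=> mpsi spsi E n g sg; rewrite E expansion_val_sum ?pval0 //.
apply: eq_bigr => s _; rewrite pvalM -addeA; congr (_ + _)%E.
have -> : pval rho (psi ^+ s) = (fine (pval rho psi) *+ s)%:E.
  elim: (nat_of_ord s) => [|i IH]; first by rewrite pval1.
  rewrite exprSr pvalM IH mulrSr EFinD fineK // pval_fin //; exact: monic_neq0.
by rewrite -EFinD -mulrnDl addrC subrK.
Qed.

(** Both constructors refer to the resulting valuation only through its values on polynomials. *)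
Lemma inductive_valuation_ext (K : fieldType) (v : K -> \bar rat)
    (rho nu : discval v) :
  pval nu =1 pval rho -> inductive_valuation rho -> inductive_valuation nu.
Proof.
move=> E ind; case: ind E =>
  {rho} [rho G E|rho rho' phi lam ind key lam0 aug E].
  by apply: Inductive_gauss => g; rewrite E.
by apply: (Inductive_augment ind key lam0) => n g sg; rewrite E aug.
Qed.

(** * The Gauss valuation as an expansion valuation *)

Section Gauss.
Context (K : fieldType) (v : K -> \bar rat) (vv : valuation v).

(** Expansions in ['X] are lists of coefficients, so the Gauss lemma becomes a case of
    [expansion_val_axioms]. *)
Lemma gauss_expansion : gauss v =1 expansion_val 'X (fun a => v a`_0) 0.
Proof.
have [pv _] := vv.
move=> g; rewrite -[g in RHS]coefK poly_def.
under [in RHS]eq_bigr do rewrite -mul_polyC.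
rewrite expansion_val_sum ?monicX ?size_polyX ?coef0 ?(pv0 pv) //.
  by apply: eq_bigr => s _; rewrite coefC mul0rn adde0.
by move=> s; rewrite ltnS size_polyC leq_b1.
Qed.

Lemma gauss_axioms : pseudo_valuation_axioms (gauss v).
Proof.
have [pv vfin] := vv; rewrite (funext gauss_expansion).
have const (a : {poly K}) : (size a < size ('X : {poly K}))%N ->
  exists c, a = c%:P.
  by rewrite size_polyX ltnS => /size1_polyC ->; exists a`_0.
apply: expansion_val_axioms; rewrite ?monicX ?size_polyX ?coef0 ?(pv0 pv) //.
- move=> a; rewrite -(size_polyX K) => /const[c ->]; rewrite coefC polyC_eq0.
  exact: vfin.
- by move=> a; rewrite pvNy.
- by rewrite coef1 (pv1 pv).
- by move=> a; rewrite coefN (pvN pv).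
- by move=> a b; rewrite coefD (pvD pv).
- move=> a b; rewrite -(size_polyX K) => /const[c ->] /const[e ->].
  rewrite -polyCM modp_small ?coefC ?(pvM pv) //.
  by rewrite size_polyX ltnS size_polyC leq_b1.
move=> a b; rewrite -(size_polyX K) => /const[c ->] /const[e ->].
rewrite -polyCM divp_small ?coef0 ?(pv0 pv) ?addye ?leey //.
by rewrite size_polyX ltnS size_polyC leq_b1.
Qed.

Lemma gauss_polyC c : gauss v c%:P = v c.
Proof.
have [pv _] := vv; rewrite gauss_expansion expansion_val_small ?coefC //.
- exact: monicX.
- by rewrite size_polyX.
- exact: pv0.
by rewrite size_polyX ltnS size_polyC leq_b1.
Qed.

Lemma gaussX : gauss v 'X = 0%E.
Proof.
have [pv _] := vv; have s2 : (1 < size ('X : {poly K}))%N by rewrite size_polyX.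
have w0 : v (0 : {poly K})`_0 = +oo%E by rewrite coef0 (pv0 pv).
rewrite gauss_expansion -[X in expansion_val _ _ _ X]mul1r.
rewrite (expansion_val_phi _ (monicX K) s2 w0) adde0.
by rewrite (expansion_val_small _ (monicX K) s2 w0) ?size_poly1 //
  coef1 (pv1 pv).
Qed.

End Gauss.

(** * Valuations below a pseudo-valuation *)

Section Interval.
Context (K : fieldType) (v : K -> \bar rat).

Lemma first_increase_exists (rho : discval v) (tau : {poly K} -> \bar rat) :
  pseudo_valuation v tau -> lt_pv (pval rho) tau ->
  exists psi, first_increase (pval rho) tau psi.
Proof.
move=> [ptau ext]; apply: first_increase_exists_of_eq_const => //.
- exact: pval_axioms.
- by move=> c; rewrite ext pvalC.
- by move=> c c0; rewrite pval_fin // polyC_eq0.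
Qed.

Lemma augment_towards (rho nu : discval v) (psi : {poly K}) (d : rat) :
  (forall g, g != 0 -> exists n : int, pval nu g = (d *~ n)%:E) ->
  le_pv (pval rho) (pval nu) -> first_increase (pval rho) (pval nu) psi ->
  exists rho' : discval v,
    [/\ inductive_valuation rho -> inductive_valuation rho',
        le_pv (pval rho') (pval nu),
        forall g, g != 0 -> exists n : int, pval rho' g = (d *~ n)%:E
      & forall f, (pval rho f < pval nu f)%E -> (pval rho f < pval rho' f)%E].
Proof.
move=> nuZ le Hpsi; have [mpsi spsi ltpsi eqn] := Hpsi.
have psi0 : psi != 0 by exact: monic_neq0.
have [k nupsi] := nuZ psi psi0.
have prho := pval_axioms rho; have pnu := pval_axioms nu.
set W := expansion_val psi (pval rho) (d *~ k).
have pW : pseudo_valuation_axioms W.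
  apply: (augmented_axioms prho pnu le Hpsi nupsi) => a; exact: pval_fin.
have Wfin g : g != 0 -> W g \is a fin_num.
  by apply: expansion_val_fin => //; [exact: pval0 | move=> a _;
    exact: pval_fin].
have WC c : W c%:P = v c.
  rewrite /W expansion_val_small ?pval0 ?pvalC //.
  by rewrite (leq_ltn_trans (size_polyC_leq1 c)).
have WX : (0 <= W 'X)%E.
  apply: le_trans (augmented_ge prho pnu le Hpsi nupsi 'X); exact: discval_x.
(* Below the degree of [psi] the values are those of [nu], and [psi] gets the value [d *~ k]. The
   alternative [+oo] covers zero terms of the expansion. *)
have WZ g : g != 0 -> exists n : int, W g = (d *~ n)%:E.
  have : W g = +oo%E \/ exists n : int, W g = (d *~ n)%:E.
    apply: (@expansion_val_prop _ _ _ _ mpsi spsi _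
      (fun x => x = +oo%E \/ exists n : int, x = (d *~ n)%:E)).
    - exact: pval0.
    - by left.
    - by move=> x y Hx Hy; rewrite minEle; case: ifP.
    - move=> x [->|[n ->]]; [by left | right; exists (n + k)].
      by rewrite mulrzDr EFinD.
    - move=> a sa; have [->|a0] := eqVneq a 0; first by left; rewrite pval0.
      by right; rewrite eqn //; exact: nuZ.
  by case=> // Wg /Wfin; rewrite Wg.
have [rho' E] := discval_of_poly (conj pW WC) WX WZ.
exists rho'; split=> [ind|g|g /WZ[n Wg]|f lt].
- apply: (Inductive_augment ind (first_increase_key_polynomial pnu le Hpsi) _
    (expansion_val_augmentation mpsi spsi E)).
  by rewrite subr_gt0 -lte_fin fineK ?pval_fin // -nupsi.
- rewrite E; exact: (augmented_le prho pnu Hpsi nupsi).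
- by exists n; rewrite E.
- by rewrite E; exact: (augmented_gt prho pnu le Hpsi nupsi).
Qed.

(* Each augmentation strictly increases the value of [f], which stays in [dZ]
   and below [nu f], so finitely many of them exhaust [nu]. *)
Lemma inductive_of_lt_above (nu : discval v) (mu : {poly K} -> \bar rat)
    (f : {poly K}) (d : rat) : pseudo_valuation v mu ->
  le_pv (pval nu) mu -> (pval nu f < mu f)%E -> 0 < d ->
  (forall g, g != 0 -> exists n : int, pval nu g = (d *~ n)%:E) ->
  forall n (rho : discval v), inductive_valuation rho ->
    (forall g, g != 0 -> exists i : int, pval rho g = (d *~ i)%:E) ->
    le_pv (pval rho) (pval nu) -> (pval nu f < pval rho f + (d *+ n)%:E)%E ->
  inductive_valuation nu.
Proof.
move=> pmu le ltf d0 nuZ; have [pmu' _] := pmu.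
have f0 : f != 0 by apply: contraTneq ltf => ->; rewrite pval0 (pv0 pmu') ltxx.
elim=> [|n IH] rho ind rhoZ lerho ltn.
  by move: ltn; rewrite adde0 ltNge lerho.
have [E|lt] := eq_or_lt_pv lerho; first exact: inductive_valuation_ext ind.
have [psi Hpsi] := first_increase_exists (conj (pval_axioms nu)
  (@pvalC _ _ nu)) lt.
have lt2 : lt_pv (pval rho) mu.
  split=> [g|e]; first exact: le_trans (lerho g) (le g).
  by have := le_lt_trans (lerho f) ltf; rewrite e ltxx.
(* The first increase towards [mu] shows that [nu] is larger than [rho] at [f]; the augmentation
   itself uses [psi], the first increase towards [nu]. *)
have [psi' Hpsi'] := first_increase_exists pmu lt2.
have ltrho := lt_pv_of_lt_above (pval_axioms rho) (pval_axioms nu) pmu' lt le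
  Hpsi' ltf.
have [rho' [ind' le' rho'Z /(_ f ltrho) lt']] := augment_towards nuZ lerho Hpsi.
apply: (IH rho') => //; first exact: ind'.
apply: (lt_le_trans ltn).
(* Both values are multiples of [d], so the strict increase is at least [d] and uses up one unit of
   [n]. *)
have [i Ei] := rhoZ f f0; have [j Ej] := rho'Z f f0.
move: lt'; rewrite Ei Ej -!EFinD lte_fin lee_fin
  -[d *~ i]mulrzl -[d *~ j]mulrzl.
rewrite ltr_pM2r // ltr_int -lezD1 => ij.
rewrite mulrS addrA lerD2r -{2}[d]mul1r -mulrDl ler_pM2r //.
by rewrite -(ler_int rat) intrD in ij.
Qed.

Lemma discval_values (nu : discval v) : exists2 d : rat, 0 < d &
  forall g, g != 0 -> exists n : int, pval nu g = (d *~ n)%:E.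
Proof.
have [d dP] := discval_cyclic nu.
have H g : g != 0 -> exists n : int, pval nu g = (d *~ n)%:E.
  move=> g0; have /dP[n En] : value_group nu (fine (pval nu g)).
    by exists (tofrac g); rewrite ?tofrac_eq0 // fineK // pval_fin.
  by exists n; rewrite -En fineK // pval_fin.
(* The generator may be negative or zero; if it is zero, all values are zero and [1] serves. *)
have [d0|d0|d0] := ltgtP d 0.
- exists (- d); first by rewrite oppr_gt0.
  by move=> g /H[n ->]; exists (- n); rewrite mulNrz mulrNz opprK.
- by exists d.
- by exists 1 => // g /H[n ->]; exists 0; rewrite d0 mul0rz mulr0z.
Qed.

(** Since [nu] extends [v], every group of multiples containing the values of [nu] contains those of
    the coefficients, hence those of [gauss v]. *)
Lemma gauss_discval (nu : discval v) :
  valuation v -> exists2 rho : discval v, pval rho =1 gauss v &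
    forall d : rat, (forall g, g != 0 ->
      exists n : int, pval nu g = (d *~ n)%:E) ->
      forall g, g != 0 -> exists n : int, pval rho g = (d *~ n)%:E.
Proof.
move=> vv; have gP := gauss_axioms vv.
have gZ (d : rat) : (forall g, g != 0 ->
  exists n : int, pval nu g = (d *~ n)%:E) ->
    forall g, g != 0 -> exists n : int, gauss v g = (d *~ n)%:E.
  move=> nuZ g g0.
  have : gauss v g = +oo%E \/ exists n : int, gauss v g = (d *~ n)%:E.
    rewrite /gauss; elim/big_ind: _ => [|x y Hx Hy|s _]; first by left.
      by rewrite minEle; case: ifP.
    have [->|a0] := eqVneq g`_s 0; first by left; case: vv => /pv0.
    by right; rewrite -(pvalC nu); apply: nuZ; rewrite polyC_eq0.
  (* The value of the leading coefficient is finite and bounds [gauss v g], which excludes [+oo]. *)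
  case=> // gy; have : (gauss v g <= v (lead_coef g))%E.
    rewrite /gauss lead_coefE.
    have sg : ((size g).-1 < size g)%N by rewrite prednK ?size_poly_gt0.
    by rewrite (bigD1 (Ordinal sg)) //= ge_min lexx.
  rewrite gy leye_eq => /eqP lcy; case: vv => _ /(_ (lead_coef g)).
  by rewrite lead_coef_eq0 lcy => /(_ g0).
have [d _ nuZ] := discval_values nu.
have gX : (0 <= gauss v 'X)%E by rewrite gaussX.
have [rho E] := discval_of_poly (conj gP (gauss_polyC vv)) gX (gZ d nuZ).
by exists rho => // d' /gZ H g /H[n gn]; exists n; rewrite E.
Qed.

Lemma interval_inductive (nu : discval v) (mu : {poly K} -> \bar rat) :
  valuation v -> pseudo_valuation v mu -> mu0_interval mu nu ->
  inductive_valuation nu.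
Proof.
move=> vv pmu [gle lt]; have [le _] := lt.
have [f ltf] := lt_pv_witness lt.
have f0 : f != 0.
  by apply: contraTneq ltf => ->; case: pmu => pmu _;
    rewrite pval0 (pv0 pmu) ltxx.
have [d d0 nuZ] := discval_values nu.
have [rho E /(_ d nuZ) rhoZ] := gauss_discval nu vv.
have [n Hn] : exists n, (pval nu f < pval rho f + (d *+ n)%:E)%E.
  have [i Ei] := rhoZ f f0; have [j Ej] := nuZ f f0.
  (* The successor makes the bound strict. *)
  exists (absz (j - i)).+1; rewrite Ei Ej -EFinD lte_fin pmulrn.
  rewrite -[d *~ i]mulrzl -[d *~ j]mulrzl -[d *~ (`|j - i|.+1)%N]mulrzl -mulrDl.
  rewrite ltr_pM2r // -intrD ltr_int; lia.
apply: (inductive_of_lt_above pmu le ltf d0 nuZ (Inductive_gauss E) rhoZ) Hn =>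
  g.
by rewrite E.
Qed.

(** Below the smaller of the two degrees, [nu] and [nu'] both agree with [mu], so their values at
    the corresponding [psi] decide the comparison. *)
Lemma below_pseudo_valuation_total (nu nu' : discval v)
    (mu : {poly K} -> \bar rat) :
  pseudo_valuation v mu -> lt_pv (pval nu) mu -> lt_pv (pval nu') mu ->
  le_pv (pval nu) (pval nu') \/ le_pv (pval nu') (pval nu).
Proof.
move=> pmu lt lt'; have [pm _] := pmu.
have [psi Hpsi] := first_increase_exists pmu lt.
have [psi' Hpsi'] := first_increase_exists pmu lt'.
wlog ss : nu nu' lt lt' psi psi' Hpsi Hpsi' / (size psi <= size psi')%N.
  move=> W; have [ss|/ltnW ss] := leqP (size psi) (size psi').
    exact: (W _ _ lt lt' _ _ Hpsi Hpsi' ss).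
  by have [] := W _ _ lt' lt _ _ Hpsi' Hpsi ss; [right | left].
have [mpsi spsi ltpsi eqm] := Hpsi; have [_ _ _ eqm'] := Hpsi'.
have [le _] := lt; have [le' _] := lt'.
have eqn (a : {poly K}) : (size a < size psi)%N -> pval nu a = pval nu' a.
  by move=> sa; rewrite eqm // eqm' // (leq_trans sa).
have pn := pval_axioms nu; have pn' := pval_axioms nu'.
have [lepsi|gtpsi] := leP (pval nu psi) (pval nu' psi).
  left; apply: (first_increase_le pn pm pn' le Hpsi) => // a sa.
  by rewrite eqn.
(* Here [nu' psi < nu psi < mu psi], so [psi] is also a first increase from [nu'] to [mu]. *)
right; apply: (first_increase_le pn' pm pn le' _ (psi := psi)) => [|a sa|].
- split=> // [|a sa]; first exact: lt_trans gtpsi ltpsi.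
  by rewrite eqm' // (leq_trans sa).
- by rewrite eqn.
- exact: ltW.
Qed.

End Interval.

Theorem theorem7p7 (K : fieldType) (v : K -> \bar rat)
    (hv : normalized_discrete_valuation v)
    (mu : {poly K} -> \bar rat) (hmu : pseudo_valuation v mu) :
  (forall nu : discval v, mu0_interval mu nu -> inductive_valuation nu) /\
  (forall nu nu' : discval v, mu0_interval mu nu -> mu0_interval mu nu' ->
     le_pv (pval nu) (pval nu') \/ le_pv (pval nu') (pval nu)).
Proof.
have [vv _] := hv; split=> [nu|nu nu' [_ lt] [_ lt']].
  exact: interval_inductive.
exact: below_pseudo_valuation_total hmu lt lt'.
Qed.
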